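(* Let $A$ be an $m \times n$ real matrix. The following two statements are equivalent. (1) For all $\mathbf{x}_1, \mathbf{x}_2 \in \mathbb{R}^n$: if $A\mathbf{x}_1 \leq A\mathbf{x}_2$, then there exist vectors $\mathbf{x}_1', \mathbf{x}_2' \in \mathbb{R}^n$ such that $A\mathbf{x}_1 = A\mathbf{x}_1'$, $A\mathbf{x}_2 = A\mathbf{x}_2'$, and $\mathbf{x}_1' \leq \mathbf{x}_2'$. (2) For all $\mathbf{x} \in \mathbb{R}^n$: if $\mathbf{0} \leq A\mathbf{x}$, then there exists a vector $\mathbf{x}' \in \mathbb{R}^n$ such that $A\mathbf{x} = A\mathbf{x}'$ and $\mathbf{0} \leq \mathbf{x}'$.
   Context: For vectors $\mathbf{u}=(u_1,\dots,u_k)$ and $\mathbf{v}=(v_1,\dots,v_k)$ in $\mathbb{R}^k$, $\mathbf{u} \leq \mathbf{v}$ means $u_j \leq v_j$ for every $j=1,\dots,k$ (the componentwise partial order). $\mathbf{0}$ denotes the zero vector of the appropriate dimension. Vectors are column vectors. *)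

(* Defs.v *)
From mathcomp Require Import all_boot all_order all_algebra.
From mathcomp Require Import reals.

Set Implicit Arguments.
Unset Strict Implicit.
Unset Printing Implicit Defensive.

Import Order.TTheory GRing.Theory Num.Theory.

Local Open Scope ring_scope.

Definition cvle (R : realType) (k : nat) (u v : 'cV[R]_k) : Prop :=
  forall j : 'I_k, u j 0 <= v j 0.

(* Not the row-space inclusion (_ <= _)%MS of mxalgebra. *)
Notation "u <=c v" := (cvle u v) (at level 70, no associativity) : ring_scope.

(* Main.v *)
Require Import Defs.
From mathcomp Require Import all_boot all_order all_algebra.
From mathcomp Require Import reals.

Set Implicit Arguments.
Unset Strict Implicit.
Unset Printing Implicit Defensive.

Import Order.TTheory GRing.Theory Num.Theory.

Local Open Scope ring_scope.

(** The componentwise order is translation invariant ([cvle_sub0]) and [A] is linear, so a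
    comparison of two vectors, or of their images, amounts to the nonnegativity of a difference.
    Statement (2) is thus (1) with one of the two vectors moved to the origin. *)

Lemma cvle_sub0 (R : realType) (k : nat) (u v : 'cV[R]_k) :
  0 <=c v - u <-> u <=c v.
Proof. by split=> le j; have := le j; rewrite !mxE subr_ge0. Qed.

Theorem proposition1 (R : realType) (m n : nat) (A : 'M[R]_(m, n)) :
  (forall x1 x2 : 'cV[R]_n, A *m x1 <=c A *m x2 ->
     exists x1' x2' : 'cV[R]_n,
       [/\ A *m x1 = A *m x1', A *m x2 = A *m x2' & x1' <=c x2'])
  <->
  (forall x : 'cV[R]_n, 0 <=c A *m x ->
     exists x' : 'cV[R]_n, A *m x = A *m x' /\ 0 <=c x').
Proof.
split=> [H x Ax_ge0 | H x1 x2 leA].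
- have [|x1 [x2 [Ax1 Ax2 le12]]] := H 0 x; first by rewrite mulmx0.
  (* Here [x1] has the same image as 0, so it lies in the kernel of [A] and subtracting it keeps the
     image of [x2]. *)
  exists (x2 - x1); split; last exact/cvle_sub0.
  by rewrite mulmxBr -Ax1 -Ax2 mulmx0 subr0.
- have [|x' [Ax' x'_ge0]] := H (x2 - x1).
    by rewrite mulmxBr; apply/cvle_sub0.
  (* [x1] need not move: [x'] has the image of [x2 - x1], so adding it to [x1] gives the image of
     [x2]. *)
  exists x1, (x1 + x'); split=> //.
    by rewrite mulmxDr -Ax' mulmxBr addrC subrK.
  by apply/cvle_sub0; rewrite addrC addrA addNr add0r.
Qed.
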